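(* Let $p=(\pi,R)$ be a mesh pattern with $\pi\in\mathfrak{S}_k$, and let $\bar p=(\pi,R^c)$ where $R^c=[0,k]^2\setminus R$. Then for every permutation $\tau\in\mathfrak{S}$, $$p(\tau)=\sum_{\sigma\in\mathfrak{S}}\lambda(\sigma)\,\sigma(\tau),\qquad\text{where }\lambda(\sigma)=(-1)^{|\sigma|-|\pi|}\,\bar p(\sigma),$$ and $\sigma(\tau)$ denotes the number of classical occurrences of $\sigma$ in $\tau$ (the sum is finite since $\sigma(\tau)=0$ when $|\sigma|>|\tau|$). Moreover, these coefficients $\lambda(\sigma)$ are the unique ones with this property.
   Context: $\mathfrak{S}_n$ is the set of permutations of $[1,n]$ and $\mathfrak{S}=\bigcup_{n\ge0}\mathfrak{S}_n$; $|\pi|$ is the length of $\pi$. A mesh pattern is a pair $p=(\pi,R)$ with $\pi\in\mathfrak{S}_k$ and $R\subseteq[0,k]\times[0,k]$. For $\tau\in\mathfrak{S}_n$ with plot $G(\tau)=\{(i,\tau(i)):i\in[1,n]\}$, an occurrence of $p$ in $\tau$ is a subset $\omega\subseteq G(\tau)$ for which there exist order-preserving injections $\alpha,\beta:[1,k]\to[1,n]$ with (i) $\omega=\{(\alpha(i),\beta(j)):(i,j)\in G(\pi)\}$, and (ii) for every $(i,j)\in R$, the box $R_{ij}=[\alpha(i)+1,\alpha(i+1)-1]\times[\beta(j)+1,\beta(j+1)-1]$ contains no point of $G(\tau)$, where $\alpha(0)=\beta(0)=0$ and $\alpha(k+1)=\beta(k+1)=n+1$. $p(\tau)$ denotes the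 number of occurrences of $p$ in $\tau$. A classical pattern $\sigma$ is identified with the mesh pattern $(\sigma,\emptyset)$, so $\sigma(\tau)$ is the number of classical occurrences of $\sigma$ in $\tau$. *)

(* Defs.v *)
From mathcomp Require Import all_boot all_order all_fingroup all_algebra.

Set Implicit Arguments.
Unset Strict Implicit.
Unset Printing Implicit Defensive.

Import GRing.Theory.

(* Permutations of all lengths; 'S_n acts on {0, ..., n-1}, so a position or
   value i of [1, n] is represented by the ordinal of value i - 1. *)
Notation perms := {n : nat & 'S_n}.

Definition plen (s : perms) : nat := tag s.

(* The shading lives on [0, k] x [0, k], whose coordinates are not shifted. *)
Definition mesh_pattern (k : nat) : Type :=
  ('S_k * {set 'I_k.+1 * 'I_k.+1})%type.

Definition graph n (t : 'S_n) : {set 'I_n * 'I_n} := [set (i, t i) | i : 'I_n].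

Definition order_injection k n (a : {ffun 'I_k -> 'I_n}) : bool :=
  injectiveb a && [forall i : 'I_k, forall j : 'I_k, (i <= j) ==> (a i <= a j)].

(* The map a seen in 1-based coordinates and extended to [0, k+1] by
   0 |-> 0 and k+1 |-> n+1. *)
Definition extended k n (a : {ffun 'I_k -> 'I_n}) (i : nat) : nat :=
  if i is i'.+1 then (if insub i' is Some j then (a j).+1 else n.+1) else 0.

Definition in_box k n (a b : {ffun 'I_k -> 'I_n}) (i j : nat)
    (z : 'I_n * 'I_n) : bool :=
  (extended a i < z.1.+1 < extended a i.+1)
  && (extended b j < z.2.+1 < extended b j.+1).

Definition is_occurrence k (p : mesh_pattern k) n (t : 'S_n)
    (w : {set 'I_n * 'I_n}) : bool :=
  (w \subset graph t)
  && [exists a : {ffun 'I_k -> 'I_n}, exists b : {ffun 'I_k -> 'I_n},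
       [&& order_injection a, order_injection b,
           w == [set (a z.1, b z.2) | z in graph p.1]
         & [forall r in p.2, forall z in graph t, ~~ in_box a b r.1 r.2 z]]].

Definition occ k (p : mesh_pattern k) (t : perms) : nat :=
  #|[set w | is_occurrence p (tagged t) w]|.

Definition classical (s : perms) : mesh_pattern (plen s) := (tagged s, set0).

Definition complement k (p : mesh_pattern k) : mesh_pattern k := (p.1, ~: p.2).

Local Open Scope ring_scope.

(* The exponent is a signed integer: |s| < k is allowed. *)
Definition lambda k (p : mesh_pattern k) (s : perms) : int :=
  (-1) ^ ((plen s)%:Z - k%:Z) * (occ (complement p) s)%:Z.

(* Main.v *)
Require Import Defs.
From mathcomp Require Import all_boot all_order all_fingroup all_algebra.

Set Implicit Arguments.
Unset Strict Implicit.
Unset Printing Implicit Defensive.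

Import GRing.Theory.

(** Every set [W] of points of [graph t] is a classical occurrence of exactly
    one permutation, its standardization, so a sum of [mu s * s(t)] over all [s]
    is the sum of [mu (std W)] over the subsets [W] of [graph t].  For
    [mu = lambda p], expanding the complement pattern's occurrences in [std W] as
    subsets [w] of [W] and exchanging the sums leaves, for each occurrence [w] of
    the underlying classical pattern, a signed sum over the [W] between [w] and
    [w :|: B], where [B] is the set of points lying in the boxes of [p.2].  It
    vanishes unless [B] is empty, i.e. unless [w] is an occurrence of [p].
    Uniqueness holds because the system is unitriangular in the length: the only
    [W] whose standardization is as long as [t] is [graph t], and it gives [t]. *)

(** * Order-preserving injections and their images *)

Lemma order_injectionP k n (a : {ffun 'I_k -> 'I_n}) :
  reflect (forall i j : 'I_k, (a i < a j) = (i < j)) (order_injection a).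
Proof.
apply: (iffP andP) => [[/injectiveP inj_a /forallP mono_a] i j | ltE].
  have leW (u v : 'I_k) : u <= v -> a u <= a v.
    by move=> uv; have /forallP/(_ v)/implyP/(_ uv) := mono_a u.
  case: (leqP j i) => [ji|ij].
    by apply/negbTE; rewrite -leqNgt; apply: leW.
  rewrite ltn_neqAle leW ?(ltnW ij) // andbT.
  apply/eqP => /val_inj/inj_a eij.
  by rewrite eij ltnn in ij.
split.
  apply/injectiveP => i j eij; apply/val_inj.
  by case: (ltngtP i j) => //; rewrite -ltE eij ltnn.
apply/forallP => i; apply/forallP => j; apply/implyP => ij.
by rewrite leqNgt ltE -leqNgt.
Qed.

Lemma order_injection_inj k n (a : {ffun 'I_k -> 'I_n}) :
  order_injection a -> injective a.
Proof. by case/andP=> /injectiveP. Qed.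

Lemma order_injection_comp k m n (a : {ffun 'I_m -> 'I_n})
    (c : {ffun 'I_k -> 'I_m}) :
  order_injection a -> order_injection [ffun i => a (c i)] = order_injection c.
Proof.
move=> /order_injectionP aE.
by apply/order_injectionP/order_injectionP => H i j; move: (H i j);
  rewrite ?ffunE aE.
Qed.

Lemma sorted_order_injection k n (a : {ffun 'I_k -> 'I_n}) :
  order_injection a -> sorted ltn [seq val x | x <- codom a].
Proof.
move=> /order_injectionP aE; rewrite /codom /image_mem -map_comp sorted_map.
have: sorted ltn [seq val x | x <- enum 'I_k].
  by rewrite val_enum_ord iota_ltn_sorted.
by rewrite sorted_map; apply: sub_sorted => i j /=; rewrite aE.
Qed.

(** The values form a strictly increasing list, and such a list is determined by its set of
    members. *)
Lemma order_injection_eq k n (a a' : {ffun 'I_k -> 'I_n}) :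
    order_injection a -> order_injection a' -> codom a =i codom a' ->
  a = a'.
Proof.
move=> oa oa' im_a.
have /(inj_map val_inj) eq_codom :
    [seq val x | x <- codom a] = [seq val x | x <- codom a'].
  apply: (irr_sorted_eq ltn_trans ltnn); try exact: sorted_order_injection.
  by apply: eq_mem_map.
apply/ffunP => i; move: eq_codom; rewrite /codom /image_mem => /eq_in_map.
by apply; rewrite mem_enum.
Qed.

(** Listing [X] by increasing value gives the map, because [enum] of a set of ordinals is sorted. *)
Lemma order_injection_of_set n (X : {set 'I_n}) :
  {a : {ffun 'I_#|X| -> 'I_n} | order_injection a & codom a =i X}.
Proof.
exists [ffun i => enum_val i].
  have srt: sorted ltn [seq val x | x <- enum X].
    rewrite sorted_map /enum_mem; apply: sorted_filter.
      by move=> x y z; apply: ltn_trans.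
    by rewrite -enumT -sorted_map val_enum_ord iota_ltn_sorted.
  have ltW (i j : 'I_#|X|) : i < j -> enum_val i < enum_val j.
    move=> ij; have x0 := enum_val i.
    have := sorted_ltn_nth ltn_trans (val x0) srt.
    move=> /(_ i j); rewrite !inE !size_map -cardE !ltn_ord => /(_ isT isT ij).
    by rewrite !(nth_map x0) -?cardE // -!enum_val_nth.
  apply/order_injectionP => i j; rewrite !ffunE.
  case: (ltngtP i j) => [/ltW//|/ltW lt_ji|/val_inj->]; last by rewrite ltnn.
  by rewrite ltnNge (ltnW lt_ji).
move=> x; apply/codomP/idP => [[i ->]|xX].
  by rewrite ffunE; apply: enum_valP.
by exists (enum_rank_in xX x); rewrite ffunE enum_rankK_in.
Qed.

(** * Gaps between consecutive values, and boxes *)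

Lemma extended_leq k n (a : {ffun 'I_k -> 'I_n}) i j :
  order_injection a -> i <= j -> extended a i <= extended a j.
Proof.
move=> /order_injectionP aE; case: i j => [|i] [|j] //= ij.
case: (insubP _ j) => [v jk vj|_].
  case: (insubP _ i) => [u _ ui|]; last by rewrite (leq_ltn_trans _ jk).
  by rewrite ltnS leqNgt aE -leqNgt ui vj.
by case: insub => [u|//]; rewrite ltnS ltnW.
Qed.

Lemma extendedE k n (a : {ffun 'I_k -> 'I_n}) (j : 'I_k) :
  extended a j.+1 = (a j).+1.
Proof. by rewrite /= valK. Qed.

Lemma codom_notin_gap k n (a : {ffun 'I_k -> 'I_n}) i (j : 'I_k) :
  order_injection a -> extended a i < (a j).+1 < extended a i.+1 = false.
Proof.
move=> oa; rewrite -extendedE; apply/negbTE; rewrite negb_and -!leqNgt.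
by apply/orP; case: (leqP i j) => ij; [right|left]; apply: extended_leq.
Qed.

Lemma gap_uniq k n (a : {ffun 'I_k -> 'I_n}) i j x :
    order_injection a ->
    extended a i < x < extended a i.+1 ->
    extended a j < x < extended a j.+1 ->
  i = j.
Proof.
move=> oa.
wlog: i j / i < j => [hwlog hi hj|ij /andP[_ xi] /andP[jx _]].
  by case: (ltngtP i j) => // ij; [|symmetry]; apply: hwlog.
have := leq_ltn_trans (extended_leq oa ij) (ltn_trans jx xi).
by rewrite ltnn.
Qed.

(** Take the least [i] with [x] below the next value. Minimality puts [x] at or above the value at
    [i], and equality would place [x] in the image. *)
Lemma gap_exists k n (a : {ffun 'I_k -> 'I_n}) (x : 'I_n) :
    x \notin codom a ->
  exists i : 'I_k.+1, extended a i < x.+1 < extended a i.+1.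
Proof.
move=> xNa; have ex: exists i, x.+1 < extended a i.+1.
  (* Index [k.+1] falls outside ['I_k], so its extended value is the sentinel [n.+1]. *)
  by exists k; rewrite /= insubF ?ltnn // ltnS.
case: (ex_minnP ex) => i xi mini.
have ik: i < k.+1.
  by rewrite ltnS; apply: mini; rewrite /= insubF ?ltnn // ltnS.
exists (Ordinal ik); rewrite /= -/(extended a i.+1) xi andbT.
case: i mini {ik xi} => [//|i] mini.
have: extended a i.+1 <= x.+1.
  by rewrite leqNgt; apply/negP => /mini; rewrite ltnn.
rewrite leq_eqVlt => /orP[/eqP|//] /=.
case: insub => [j /succn_inj/val_inj ejx|[enx]].
  by rewrite -ejx codom_f in xNa.
by have := ltn_ord x; rewrite -[val x]enx ltnn.
Qed.

(** Both maps reflect strict order, so comparisons with inner box sides pull back. The outer sides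
    lie beyond every point, before and after the embedding. *)
Lemma in_box_comp k m n (a b : {ffun 'I_m -> 'I_n})
    (c d : {ffun 'I_k -> 'I_m}) i j z :
    order_injection a -> order_injection b ->
  in_box [ffun u => a (c u)] [ffun u => b (d u)] i j (a z.1, b z.2)
  = in_box c d i j z.
Proof.
move=> /order_injectionP aE /order_injectionP bE; rewrite /in_box.
have ltl (e : {ffun 'I_m -> 'I_n}) (f : {ffun 'I_k -> 'I_m}) u x :
    (forall v w : 'I_m, (e v < e w) = (v < w)) ->
    ((extended [ffun v => e (f v)] u < (e x).+1) = (extended f u < x.+1))
    * (((e x).+1 < extended [ffun v => e (f v)] u) = (x.+1 < extended f u)).
  move=> eE; case: u => [//|u] /=.
  case: insub => [v|]; first by rewrite ffunE !ltnS !eE.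
  have bnd r (y : 'I_r) : ((r.+1 < y.+1) = false) * ((y.+1 < r.+1) = true).
    by rewrite !ltnS ltn_ord; split; first by apply/negbTE; rewrite -leqNgt ltnW.
  by rewrite !bnd.
by rewrite !ltl.
Qed.

(** * Images of plots under pairs of injections *)

Definition plot_image m n (a b : {ffun 'I_m -> 'I_n})
    (w : {set 'I_m * 'I_m}) : {set 'I_n * 'I_n} :=
  [set (a z.1, b z.2) | z in w].

Lemma plot_image_inj m n (a b : {ffun 'I_m -> 'I_n}) :
  order_injection a -> order_injection b -> injective (plot_image a b).
Proof.
move=> /order_injection_inj ia /order_injection_inj ib.
by apply: imset_inj => -[x y] [x' y'] /= [/ia-> /ib->].
Qed.

Lemma plot_image_comp k m n (a b : {ffun 'I_m -> 'I_n})
    (c d : {ffun 'I_k -> 'I_m}) w :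
  plot_image [ffun u => a (c u)] [ffun u => b (d u)] w
  = plot_image a b (plot_image c d w).
Proof.
by rewrite /plot_image -imset_comp; apply: eq_imset => z /=; rewrite !ffunE.
Qed.

Local Notation tagperm t := (existT (fun n => 'S_n) _ t).

Lemma mem_graph n (t : 'S_n) z : (z \in graph t) = (t z.1 == z.2).
Proof.
apply/imsetP/eqP => [[i _ ->]//|tz].
by exists z.1; rewrite // tz -surjective_pairing.
Qed.

Lemma card_graph n (t : 'S_n) : #|graph t| = n.
Proof. by rewrite card_imset ?card_ord // => i j []. Qed.

Lemma fst_plot_graph k n (a b : {ffun 'I_k -> 'I_n}) (t : 'S_k) :
  [set z.1 | z in plot_image a b (graph t)] =i codom a.
Proof.
move=> x; apply/imsetP/codomP => [[_ /imsetP[z _ ->] ->]|[i ->]].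
  by exists z.1.
exists (a i, b (t i)) => //; apply/imsetP; exists (i, t i) => //.
by rewrite mem_graph.
Qed.

Lemma snd_plot_graph k n (a b : {ffun 'I_k -> 'I_n}) (t : 'S_k) :
  [set z.2 | z in plot_image a b (graph t)] =i codom b.
Proof.
move=> y; apply/imsetP/codomP => [[_ /imsetP[z _ ->] ->]|[i ->]].
  by exists z.2.
exists (a ((t^-1)%g i), b i) => //; apply/imsetP; exists ((t^-1)%g i, i) => //.
by rewrite mem_graph /= permKV.
Qed.

(** The two projections of the point set are the images of [a] and [b], which determine these maps;
    injectivity of [plot_image] then recovers the permutation. *)
Lemma plot_graph_eq k n (a b a' b' : {ffun 'I_k -> 'I_n}) (s s' : 'S_k) :
    order_injection a -> order_injection b ->
    order_injection a' -> order_injection b' ->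
    plot_image a b (graph s) = plot_image a' b' (graph s') ->
  [/\ a = a', b = b' & s = s'].
Proof.
move=> oa ob oa' ob' eqW.
have ea: a = a'.
  by apply: order_injection_eq => // x;
  rewrite -(fst_plot_graph _ b s) eqW fst_plot_graph.
have eb: b = b'.
  by apply: order_injection_eq => // x;
  rewrite -(snd_plot_graph a _ s) eqW snd_plot_graph.
split=> //; subst a' b'; move/(plot_image_inj oa ob)/setP: eqW => eqG.
apply/permP => i; have := eqG (i, s i).
by rewrite !mem_graph eqxx /= => /esym/eqP->.
Qed.

(** * Occurrences relative to a point set *)

(* Occurrences relative to a set of points [W]; [is_occurrence p t] is the case
   [W = graph t]. *)
Definition occ_in k (p : mesh_pattern k) n (W w : {set 'I_n * 'I_n}) : bool :=
  (w \subset W)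
  && [exists a : {ffun 'I_k -> 'I_n}, exists b : {ffun 'I_k -> 'I_n},
       [&& order_injection a, order_injection b,
           w == plot_image a b (graph p.1)
         & [forall r in p.2, forall z in W, ~~ in_box a b r.1 r.2 z]]].

Lemma is_occurrenceE k (p : mesh_pattern k) n (t : 'S_n) w :
  is_occurrence p t w = occ_in p (graph t) w.
Proof. by []. Qed.

Lemma occ_inP k (p : mesh_pattern k) n (W w : {set 'I_n * 'I_n}) :
  reflect (w \subset W /\ exists a b : {ffun 'I_k -> 'I_n},
      [/\ order_injection a, order_injection b,
          w = plot_image a b (graph p.1)
        & forall r z, r \in p.2 -> z \in W -> ~~ in_box a b r.1 r.2 z])
    (occ_in p W w).
Proof.
apply: (iffP andP) => -[wW].
  case/existsP=> a /existsP[b] /and4P[oa ob /eqP ew /forall_inP noz].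
  split=> //; exists a, b; split=> // r z /noz/forall_inP; exact.
case=> a [b [oa ob ew noz]]; split=> //; apply/existsP; exists a.
apply/existsP; exists b; rewrite oa ob ew eqxx /=.
by apply/forall_inP => r pr; apply/forall_inP => z; apply: noz.
Qed.

Lemma occ_in_card k (p : mesh_pattern k) n (W w : {set 'I_n * 'I_n}) :
  occ_in p W w -> #|w| = k.
Proof.
case/occ_inP=> _ [a [b [/order_injection_inj ia /order_injection_inj ib -> _]]].
rewrite card_imset ?card_graph // => -[x y] [x' y'] /= [/ia-> /ib->] //.
Qed.

Lemma occ_classicalP m (s : 'S_m) n (t : 'S_n)
    (W : {set 'I_n * 'I_n}) :
  reflect (W \subset graph t /\ exists a b : {ffun 'I_m -> 'I_n},
      [/\ order_injection a, order_injection b & W = plot_image a b (graph s)])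
    (is_occurrence (classical (tagperm s)) t W).
Proof.
rewrite is_occurrenceE; apply: (iffP (occ_inP _ _ _)) => -[Wt [a [b H]]].
  by case: H => oa ob eW _; split=> //; exists a, b.
by case: H => oa ob eW; split=> //; exists a, b; split=> // r z; rewrite inE.
Qed.

(** Occurrences move along an embedding of plots. Pulling back requires factoring the embedding
    [(c, d)] of the pattern through [(a, b)]. *)
Lemma occ_in_plot k (p : mesh_pattern k) m n (a b : {ffun 'I_m -> 'I_n}) W w :
    order_injection a -> order_injection b ->
  occ_in p (plot_image a b W) (plot_image a b w) = occ_in p W w.
Proof.
move=> oa ob.
have injp: injective (fun z : 'I_m * 'I_m => (a z.1, b z.2)).
  move=> [x y] [x' y'] /= [].
  by move=> /(order_injection_inj oa)-> /(order_injection_inj ob)->.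
have subE u v : (plot_image a b u \subset plot_image a b v) = (u \subset v).
  apply/idP/idP => [/subsetP uv|]; last exact: imsetS.
  by apply/subsetP => z zu; have := uv _ (imset_f _ zu); rewrite mem_imset.
apply/occ_inP/occ_inP; rewrite subE => -[wW].
  case=> c [d [oc od ew noz]]; split=> //.
  (* Each value of [c] is the abscissa of a point of [plot_image a b w], hence a value of [a];
     likewise for [d] and [b]. *)
  have fc i : exists j, a j == c i.
    have: c i \in codom c by apply: codom_f.
    rewrite -(fst_plot_graph c d p.1) -ew => /imsetP[_ /imsetP[z _ ->] /= ->].
    by exists z.1.
  have fd i : exists j, b j == d i.
    have: d i \in codom d by apply: codom_f.
    rewrite -(snd_plot_graph c d p.1) -ew => /imsetP[_ /imsetP[z _ ->] /= ->].
    by exists z.2.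
  pose c' : {ffun 'I_k -> 'I_m} := [ffun i => xchoose (fc i)].
  pose d' : {ffun 'I_k -> 'I_m} := [ffun i => xchoose (fd i)].
  have ec: c = [ffun i => a (c' i)].
    by apply/ffunP=> i; rewrite !ffunE; apply/esym/eqP/(xchooseP (fc i)).
  have ed: d = [ffun i => b (d' i)].
    by apply/ffunP=> i; rewrite !ffunE; apply/esym/eqP/(xchooseP (fd i)).
  exists c', d'; split.
  - by rewrite -(order_injection_comp _ oa) -ec.
  - by rewrite -(order_injection_comp _ ob) -ed.
  - by apply: (plot_image_inj oa ob); rewrite -plot_image_comp -ec -ed.
  move=> r z rp zW; rewrite -(in_box_comp _ _ _ _ _ oa ob) -ec -ed.
  by apply: noz; rewrite // mem_imset.
case=> c [d [oc od ew noz]]; split=> //.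
exists [ffun i => a (c i)], [ffun i => b (d i)]; split.
- by rewrite order_injection_comp.
- by rewrite order_injection_comp.
- by rewrite plot_image_comp ew.
by move=> r _ rp /imsetP[z zW ->]; rewrite in_box_comp //; apply: noz.
Qed.

(** [W] is an embedded copy of the graph of [s], so occurrences in [s] can be counted as subsets of
    [W], inside the plot of [t]. *)
Lemma occ_in_classical k (p : mesh_pattern k) (s : perms) n (t : 'S_n) W :
    is_occurrence (classical s) t W ->
  occ p s = #|[set w | occ_in p W w]|.
Proof.
case: s => m s /occ_classicalP[_ [a [b [oa ob eW]]]].
rewrite /occ /= -(card_imset _ (plot_image_inj oa ob)); apply: eq_card => w.
rewrite inE; apply/imsetP/idP => [[v]|wW].
  by rewrite inE is_occurrenceE -(occ_in_plot _ _ _ oa ob) -eW => ? ->.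
have [v ev]: exists v, w = plot_image a b v.
  exists [set z in graph s | (a z.1, b z.2) \in w].
  apply/setP => x; apply/idP/imsetP => [xw|[z]].
    have [/subsetP/(_ _ xw)] := occ_inP _ _ _ wW.
    rewrite eW => /imsetP[z zs ex] _; exists z => //.
    by rewrite inE zs -ex.
  by rewrite inE => /andP[_ ?] ->.
exists v => //; rewrite inE is_occurrenceE -(occ_in_plot _ _ _ oa ob) -eW -ev //.
Qed.

(** * Standardization of subsets of a graph *)

(** Enumerate the abscissas and the ordinates of [W] increasingly by [a] and [b]; the permutation
    sends [i] to the rank [j] with [b j = t (a i)]. *)
Lemma standardization n (t : 'S_n) (W : {set 'I_n * 'I_n}) :
  W \subset graph t -> {s : perms | is_occurrence (classical s) t W}.
Proof.
move=> Wt; pose X := [set z.1 | z in W].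
have XW x : x \in X -> (x, t x) \in W.
  case/imsetP=> -[u v] uvW -> /=; have := subsetP Wt _ uvW.
  by rewrite mem_graph => /eqP /= ->.
have [a oa ca] := order_injection_of_set X.
have [b ob cb] := order_injection_of_set [set t x | x in X].
(* As [t] is injective, [W] has as many ordinates as abscissas, so [a] and [b] get the same
   domain. *)
rewrite card_imset in b ob cb *; last exact: perm_inj.
have fs i : {j | b j == t (a i)}.
  apply: sigW; have: t (a i) \in codom b.
    by rewrite cb imset_f // -ca codom_f.
  by case/codomP=> j ->; exists j.
have inj_s: injective (fun i => sval (fs i)).
  move=> i j; case: (fs i) (fs j) => [u /eqP eu] [v /eqP ev] /= uv.
  apply: (order_injection_inj oa); apply: (@perm_inj _ t).
  by rewrite -eu -ev uv.
exists (tagperm (perm inj_s)); apply/occ_classicalP; split=> //.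
exists a, b; split=> //; apply/setP => -[x y]; apply/idP/imsetP.
  move=> xyW; have: x \in codom a by rewrite ca; apply/imsetP; exists (x, y).
  case/codomP=> i ex; exists (i, perm inj_s i); first by rewrite mem_graph.
  rewrite /= permE; case: (fs i) => j /= /eqP->.
  have := subsetP Wt _ xyW; rewrite mem_graph /= => /eqP <-.
  by rewrite ex.
case=> -[i j]; rewrite mem_graph /= permE => /eqP <- [-> ->].
case: (fs i) => v /= /eqP ->; apply: XW.
by rewrite -ca codom_f.
Qed.

Definition standardizes n (t : 'S_n) (std : {set 'I_n * 'I_n} -> perms) :=
  forall W : {set 'I_n * 'I_n},
    W \subset graph t -> is_occurrence (classical (std W)) t W.

Definition standardizations n (t : 'S_n) :
  {std : {set 'I_n * 'I_n} -> perms |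
    standardizes t std}.
Proof.
have std (W : {set 'I_n * 'I_n}) :
    {s | W \subset graph t -> is_occurrence (classical s) t W}.
  case: (boolP (W \subset graph t)) => [/standardization[s sW]|_]; first by exists s.
  (* Default value: the empty permutation, for sets not contained in the graph. *)
  by exists (tagperm (1%g : 'S_0)).
by exists (fun W => sval (std W)) => W; case: (std W).
Qed.

(** Both lengths equal [#|W|], after which [plot_graph_eq] applies. *)
Lemma standardization_uniq n (t : 'S_n) (s s' : perms) W :
  is_occurrence (classical s) t W -> is_occurrence (classical s') t W -> s = s'.
Proof.
case: s s' => m s [m' s'] oW oW'.
have em := occ_in_card oW; have em' := occ_in_card oW'.
rewrite /plen /= in em em'; move: em'; rewrite em => em'; subst m'.
have [_ [a [b [oa ob eW]]]] := occ_classicalP _ _ _ oW.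
have [_ [a' [b' [oa' ob' eW']]]] := occ_classicalP _ _ _ oW'.
have [_ _ ->//] : [/\ a = a', b = b' & s = s'].
by apply: plot_graph_eq => //; rewrite -eW.
Qed.

Lemma is_occurrence_graph (t : perms) :
  is_occurrence (classical t) (tagged t) (graph (tagged t)).
Proof.
case: t => n t; apply/occ_classicalP; split=> //=.
exists [ffun i => i], [ffun i => i]; split.
- by apply/order_injectionP => i j; rewrite !ffunE.
- by apply/order_injectionP => i j; rewrite !ffunE.
apply/setP => z; apply/idP/imsetP => [zt|[u ut ->]].
  by exists z; rewrite // !ffunE -surjective_pairing.
by rewrite !ffunE -surjective_pairing.
Qed.

(** * Point sets containing a fixed embedded pattern *)

(* The points that a larger occurrence may add to the image of [(a, b)]
   without entering a box of the complement of [R]. *)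
Definition shaded k n (a b : {ffun 'I_k -> 'I_n})
    (R : {set 'I_k.+1 * 'I_k.+1}) (t : 'S_n) : {set 'I_n * 'I_n} :=
  [set z in graph t | [exists r in R, in_box a b r.1 r.2 z]].

Lemma in_box_plot_graph k n (a b : {ffun 'I_k -> 'I_n}) (s : 'S_k) i j z :
  order_injection a -> z \in plot_image a b (graph s) -> ~~ in_box a b i j z.
Proof. by move=> oa /imsetP[u _ ->]; rewrite /in_box codom_notin_gap. Qed.

Section FixedOccurrence.

Variables (k : nat) (p : mesh_pattern k) (n : nat) (t : 'S_n).
Variables a b : {ffun 'I_k -> 'I_n}.
Hypotheses (oa : order_injection a) (ob : order_injection b).

Let w := plot_image a b (graph p.1).
Let B := shaded a b p.2 t.

(** The embedding of an occurrence is determined by its points, so the existential over maps reduces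
    to the fixed [a] and [b]. *)
Lemma occ_in_plot_graph (q : mesh_pattern k) (W : {set 'I_n * 'I_n}) :
    q.1 = p.1 ->
  reflect (w \subset W
      /\ forall r z, r \in q.2 -> z \in W -> ~~ in_box a b r.1 r.2 z)
    (occ_in q W w).
Proof.
move=> eq1; apply: (iffP (occ_inP _ _ _)) => -[wW].
  case=> a' [b' [oa' ob' ew noz]]; split=> //.
  by have [-> -> _] := plot_graph_eq oa ob oa' ob' ew.
by move=> noz; split=> //; exists a, b; rewrite eq1.
Qed.

(** On the graph of a permutation, a point sharing a row or column with a point of [w] is that
    point. Hence both coordinates of [z] fall in gaps. *)
Lemma box_exists z :
    w \subset graph t -> z \in graph t -> z \notin w ->
  exists r : 'I_k.+1 * 'I_k.+1, in_box a b r.1 r.2 z.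
Proof.
move=> wt zt zNw; have tz := zt; rewrite mem_graph in tz.
have z1: z.1 \notin codom a.
  rewrite -(fst_plot_graph a b p.1); apply: contra zNw => /imsetP[u uw ezu].
  have := subsetP wt _ uw; rewrite mem_graph -ezu (eqP tz) => /eqP ezu2.
  by rewrite [z]surjective_pairing ezu ezu2 -surjective_pairing.
have z2: z.2 \notin codom b.
  rewrite -(snd_plot_graph a b p.1); apply: contra zNw => /imsetP[u uw ezu].
  have := subsetP wt _ uw; rewrite mem_graph -ezu -(eqP tz) => /eqP/perm_inj ezu1.
  by rewrite [z]surjective_pairing ezu -ezu1 -surjective_pairing.
have [i hi] := gap_exists z1; have [j hj] := gap_exists z2.
by exists (i, j); rewrite /in_box hi hj.
Qed.

Lemma in_box_uniq (r r' : 'I_k.+1 * 'I_k.+1) z :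
  in_box a b r.1 r.2 z -> in_box a b r'.1 r'.2 z -> r = r'.
Proof.
move=> /andP[h1 h2] /andP[h1' h2'].
rewrite [r]surjective_pairing [r']surjective_pairing.
by congr (_, _); apply: val_inj; [apply: (gap_uniq oa h1)|apply: (gap_uniq ob h2)].
Qed.

(** [B] is disjoint from [w], since points of [w] lie in no box; so the right-hand side says that
    [B] is empty. *)
Lemma occ_in_shaded :
  w \subset graph t -> occ_in p (graph t) w = (w == w :|: B).
Proof.
move=> wt; apply/occ_in_plot_graph/eqP => // [[_ noz]|ewB].
  apply/esym/setUidPl/subsetP => z; rewrite inE => /andP[zt].
  by case/existsP=> r /andP[rp]; rewrite (negbTE (noz _ _ rp zt)).
split=> // r z rp zt; apply/negP => zr.
have: z \in w.
  rewrite ewB !inE zt orbC; apply/orP; left.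
  by apply/existsP; exists r; rewrite rp.
by move/(in_box_plot_graph r.1 r.2 oa); rewrite zr.
Qed.

(** A point of [W] outside [w] lies in exactly one box. It avoids all boxes of the complement
    exactly when its own box is in [p.2]. *)
Lemma occ_in_complement (W : {set 'I_n * 'I_n}) :
    w \subset graph t ->
  (W \subset graph t) && occ_in (complement p) W w
  = (w \subset W) && (W \subset w :|: B).
Proof.
move=> wt; apply/andP/andP => -[].
  move=> Wt /occ_in_plot_graph -/(_ erefl)[wW noz]; split=> //.
  apply/subsetP => z zW; rewrite inE; case: (boolP (z \in w)) => //= zNw.
  have zt := subsetP Wt _ zW; rewrite inE zt /=.
  have [r zr] := box_exists wt zt zNw; apply/existsP; exists r; rewrite zr andbT.
  by apply/negPn/negP => rNp; have := noz r z; rewrite inE rNp zr => /(_ isT zW).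
move=> wW WwB; split.
  apply: subset_trans WwB _; rewrite subUset wt; apply/subsetP => z.
  by rewrite inE => /andP[].
apply/occ_in_plot_graph => //; split=> // r z; rewrite inE => rNp zW.
have := subsetP WwB _ zW; rewrite inE => /orP[zw|].
  exact: in_box_plot_graph zw.
rewrite inE => /andP[_ /existsP[r' /andP[r'p zr']]].
by apply: contra rNp => zr; rewrite (in_box_uniq zr zr').
Qed.

End FixedOccurrence.

(** * Signed sums over subsets *)

Local Open Scope ring_scope.

(** If [w] is not [V], toggling an element [x] of [V] outside [w] is a sign-reversing involution of
    the interval, so the sum equals its opposite. *)
Lemma sum_sign_interval (T : finType) (w V : {set T}) : w \subset V ->
  \sum_(W : {set T} | (w \subset W) && (W \subset V)) (-1) ^+ #|W|
  = (-1) ^+ #|w| *+ (w == V) :> int.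
Proof.
move=> wV; case: eqVneq => [<-|wNV].
  rewrite (big_pred1 w) // => W; rewrite andbC -eqEsubset //.
have /subsetPn[x xV xNw] : ~~ (V \subset w).
  by apply: contra wNV => Vw; rewrite eqEsubset wV.
pose tog (W : {set T}) := if x \in W then W :\ x else x |: W.
have togK : involutive tog.
  move=> W; rewrite /tog; case: (ifPn (x \in W)) => xW.
    by rewrite setD11 setD1K.
  by rewrite setU11 setU1K.
have H (S : int) : S = - S -> S = 0.
  by move/eqP; rewrite -addr_eq0 -mulr2n Num.Theory.mulrn_eq0 /= => /eqP.
apply: H; rewrite {1}(reindex_inj (inv_inj togK)) -sumrN.
apply: eq_big => W; rewrite /tog; case: ifPn => xW.
- by rewrite subsetD1 xNw andbT subDset (setUidPr _) ?sub1set.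
- rewrite -subDset (setDidPl _) ?subUset ?sub1set ?xV //.
  by rewrite disjoint_sym disjoints1.
- by move=> _; rewrite [#|W|](cardsD1 x) xW exprS mulN1r opprK.
- by move=> _; rewrite cardsU1 xW exprS mulN1r.
Qed.

Lemma signz_sub (m k : nat) :
  (-1 : int) ^ (m%:Z - k%:Z) = (-1) ^+ m * (-1) ^+ k.
Proof.
by rewrite exprzDr ?unitrN1 // -invr_expz -exprnP -exprnP -exprVn invrN1.
Qed.

(** When [w] is a classical occurrence of [p.1], the sum runs over the interval from [w] to
    [w :|: B]; otherwise both sides vanish. *)
Lemma sum_sign_occ_in k (p : mesh_pattern k) n (t : 'S_n) w :
  \sum_(W : {set 'I_n * 'I_n} | (W \subset graph t) && occ_in (complement p) W w)
     (-1) ^+ #|W| = (-1) ^+ k * (occ_in p (graph t) w)%:R :> int.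
Proof.
case: (boolP [exists a : {ffun 'I_k -> 'I_n}, exists b : {ffun 'I_k -> 'I_n},
  [&& order_injection a, order_injection b, w == plot_image a b (graph p.1)
    & w \subset graph t]]).
  case/existsP=> a /existsP[b] /and4P[oa ob /eqP ew wt]; subst w.
  under eq_bigl do rewrite occ_in_complement //.
  rewrite sum_sign_interval ?subsetUl // -occ_in_shaded // mulr_natr.
  by case E: occ_in; rewrite ?mulr0n // (occ_in_card E).
move=> /existsPn noab.
(* Stated for any shading, to serve both [p] and its complement. *)
have noW (q : mesh_pattern k) (W : {set 'I_n * 'I_n}) :
  q.1 = p.1 -> W \subset graph t -> ~~ occ_in q W w.
  move=> eq1 Wt; apply/negP => /occ_inP[wW [a [b [oa ob ew _]]]].
  have /existsPn/(_ b) := noab a.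
  by rewrite oa ob ew -eq1 eqxx -ew (subset_trans wW Wt).
rewrite (negbTE (noW _ _ _ _)) // mulr0 big_pred0 // => W.
by apply/negP => /andP[Wt]; apply/negP/noW.
Qed.

Lemma sum_lambda_std k (p : mesh_pattern k) n (t : 'S_n)
    (std : {set 'I_n * 'I_n} -> perms) :
    standardizes t std ->
  \sum_(W : {set 'I_n * 'I_n} | W \subset graph t) lambda p (std W)
  = (occ p (tagperm t))%:Z.
Proof.
move=> stdP.
transitivity (\sum_(W : {set 'I_n * 'I_n} | W \subset graph t)
  \sum_(w | occ_in (complement p) W w)
    ((-1) ^+ #|W| * (-1) ^+ k : int)).
  apply: eq_bigr => W Wt; have sW := stdP W Wt.
  rewrite /lambda signz_sub (occ_in_classical _ sW) -(occ_in_card sW).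
  rewrite sumr_const -natz mulr_natr; congr (_ *+ _).
  by apply: eq_card => w; rewrite inE.
rewrite (exchange_big_dep predT) //=.
(* The inner signed sum contributes a second [(-1) ^+ k], cancelling the one from [lambda]. *)
under eq_bigr do
  rewrite -mulr_suml sum_sign_occ_in mulrAC -expr2 sqrr_sign mul1r.
rewrite /occ -natz -sum1_card natr_sum [RHS]big_mkcond /=.
apply: eq_bigr => w _.
by rewrite inE is_occurrenceE; case: occ_in.
Qed.

(** The occurrences of [s] in [t] form the fibre of [std] over [s], so the sum over [s] regroups the
    subsets [W] by standardization. *)
Lemma sum_occ_seq (A : nzRingType) (mu : perms -> A) n (t : 'S_n)
    (std : {set 'I_n * 'I_n} -> perms) (r : seq perms) :
    standardizes t std ->
    uniq r -> (forall W : {set 'I_n * 'I_n}, W \subset graph t -> std W \in r) ->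
  \sum_(s <- r) mu s * (occ (classical s) (tagperm t))%:R
  = \sum_(W : {set 'I_n * 'I_n} | W \subset graph t) mu (std W).
Proof.
move=> stdP uniq_r std_r.
transitivity (\sum_(s <- r)
    \sum_(W : {set 'I_n * 'I_n} | (W \subset graph t) && (s == std W)) mu s).
  apply: eq_bigr => s _; rewrite sumr_const mulr_natr; congr (_ *+ _).
  apply: eq_card => W; rewrite !inE /=; apply/idP/andP.
    move=> sW; have Wt : W \subset graph t by case/andP: (sW).
    by split; rewrite // (standardization_uniq sW (stdP W Wt)).
  by case=> Wt /eqP ->; apply: stdP.
rewrite (exchange_big_dep
  (fun W : {set 'I_n * 'I_n} => W \subset graph t)) /=; last first.
  by move=> s W _ /andP[].
apply: eq_bigr => W Wt.
rewrite big_mkcond (bigD1_seq (std W)) ?std_r //= Wt eqxx big1 ?addr0 //.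
by move=> s /negPf->.
Qed.

(* Sums over all permutations, and uniqueness of the coefficients *)
From mathcomp Require Import boolp classical_sets functions cardinality fsbigop.

Local Open Scope classical_set_scope.
Local Open Scope ring_scope.

Lemma occ_neq0_std n (t : 'S_n) (std : {set 'I_n * 'I_n} -> perms) (s : perms) :
    standardizes t std ->
    occ (classical s) (tagperm t) <> 0%N ->
  exists2 W : {set 'I_n * 'I_n}, W \subset graph t & s = std W.
Proof.
move=> stdP /eqP; rewrite -lt0n => /card_gt0P[W]; rewrite inE /= => sW.
have Wt : W \subset graph t by case/andP: (sW).
by exists W => //; apply: standardization_uniq sW (stdP W Wt).
Qed.

Lemma sum_occ_std (A : nzRingType) (mu : perms -> A) n (t : 'S_n)
    (std : {set 'I_n * 'I_n} -> perms) :
    standardizes t std ->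
  \sum_(s \in [set: perms]) mu s * (occ (classical s) (tagperm t))%:R
  = \sum_(W : {set 'I_n * 'I_n} | W \subset graph t) mu (std W).
Proof.
(* Distinct subsets may have the same standardization, so duplicates are removed. [r] contains the
   support of the summand. *)
move=> stdP; pose r := undup [seq std W
  | W : {set 'I_n * 'I_n} in powerset (graph t)].
have std_r (W : {set 'I_n * 'I_n}) : W \subset graph t -> std W \in r.
  by move=> Wt; rewrite mem_undup fintype.image_f // inE.
rewrite -(sum_occ_seq mu stdP (undup_uniq _) std_r).
rewrite (fsbigE r) ?undup_uniq //.
  by apply: eq_bigl => s; rewrite in_setT.
move=> s _ sNr.
case: (eqVneq (occ (classical s) (tagperm t)) 0%N) => [->|/eqP].
  by rewrite mulr0.
by case/(occ_neq0_std stdP) => W Wt es; rewrite es std_r in sNr.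
Qed.

Theorem mainTheorem1 (A : nzRingType) (k : nat) (p : mesh_pattern k) :
  [/\ forall s t : perms, (plen t < plen s)%N -> occ (classical s) t = 0%N,
      forall t : perms, finite_set [set s : perms | occ (classical s) t <> 0%N],
      forall t : perms,
        (occ p t)%:R =
          \sum_(s \in [set: perms]) ((lambda p s)%:~R : A) * (occ (classical s) t)%:R
    & forall mu : perms -> A,
        (forall t : perms,
          (occ p t)%:R =
            \sum_(s \in [set: perms]) mu s * (occ (classical s) t)%:R) ->
        forall s : perms, mu s = (lambda p s)%:~R].
Proof.
have sumE (t : perms) : (occ p t)%:R =
    \sum_(s \in [set: perms]) ((lambda p s)%:~R : A) * (occ (classical s) t)%:R.
  case: t => n t; have [std stdP] := standardizations t.
  rewrite (sum_occ_std (fun s => (lambda p s)%:~R : A) stdP).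
  by rewrite -rmorph_sum /= (sum_lambda_std p stdP).
split=> //.
- move=> s t; apply: contraTeq; rewrite -lt0n -leqNgt => /card_gt0P[W].
  rewrite inE => sW; rewrite -(occ_in_card sW) -[plen t](card_graph (tagged t)).
  by apply: subset_leq_card; case/andP: sW.
- case=> n t; have [std stdP] := standardizations t.
  apply: (sub_finite_set _ (finite_seq [seq std W
    | W : {set 'I_n * 'I_n} in powerset (graph t)])).
  move=> s /(occ_neq0_std stdP)[W Wt ->] /=.
  by rewrite fintype.image_f // inE.
(* Uniqueness goes by strong induction on the length of [s], testing both expansions on [s]
   itself. *)
move=> mu muE s; have [m] := ubnP (plen s).
elim: m s => // m IHm [n t]; rewrite ltnS => nm.
have [std stdP] := standardizations t.
have := etrans (esym (muE _)) (sumE (tagperm t)).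
rewrite !(sum_occ_std _ stdP) (bigD1 (graph t)) //= [RHS](bigD1 (graph t)) //=.
have -> : std (graph t) = tagperm t.
  have occ_t := is_occurrence_graph (tagperm t).
  exact: standardization_uniq (stdP _ (subxx_hint _)) occ_t.
(* [x] and [y] collect the proper subsets of the graph. Their standardizations are shorter, so the
   induction hypothesis identifies the two sums, and cancelling them leaves the coefficients of
   [t]. *)
set x := (X in _ + X = _); set y := (X in _ = _ + X) => exy.
suff exy' : x = y by rewrite exy' in exy; exact: addIr exy.
apply: eq_bigr => W; rewrite andbC -finset.properEneq => Wt; apply: IHm.
have := proper_card Wt; rewrite card_graph (occ_in_card (stdP W (proper_sub Wt))).
by move/leq_trans; apply.
Qed.
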